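(* For each of the 62 vertices $v\in\mathbb{R}^3$ of the M120p, put $(x',y',z')=v/(2\varphi^2)$, $r'^2=x'^2+y'^2+z'^2$ and $w=+\sqrt{1-r'^2}$ (one has $r'\le 1$). Then the unit quaternion $w+x'i+y'j+z'k$ is an element of the binary icosahedral group $2I$. Moreover $w=\tfrac12$ for the 20 Type A vertices, $w=\tfrac{1}{2\varphi}$ for the 12 Type C vertices, and $w=0$ for the 30 Type B vertices, and the 62 elements of $2I$ obtained in this way are precisely the elements of $2I$ whose scalar part lies in $\{0,\tfrac12,\tfrac{1}{2\varphi}\}$.
   Context: Let $\varphi=(1+\sqrt5)/2$. Quaternions are written $q=w+xi+yj+zk$, identified with $(w,x,y,z)\in\mathbb{R}^4$; $w$ is the scalar part. The binary icosahedral group $2I$ is the group of 120 unit quaternions consisting of: (a) the 8 elements $\pm1,\pm i,\pm j,\pm k$; (b) the 16 elements $\tfrac12(\pm1\pm i\pm j\pm k)$; (c) the 96 elements whose coordinate vectors $(w,x,y,z)$ are $\tfrac12(0,\pm1,\pm\varphi,\pm\varphi^{-1})$ and all even permutations of these coordinates, with all choices of signs. The M120p has 62 vertices in $\mathbb{R}^3$ of three types (all independent sign choices are allowed): Type A (20 vertices): $(\pm\varphi^2,\pm\varphi^2,\pm\varphi^2)$ and the cyclic permutations of $(\pm\varphi^3,0,\pm\varphi)$. Type C (12 vertices): the cyclic permutations of $(\pm\varphi^3,\pm\varphi^2,0)$. Type B (30 vertices): the cyclic permutations of $(\pm2\varphi^2,0,0)$ and the cyclic permutations of $(\pm\varphi^3,\pm\varphi,\pm\varphi^2)$.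 *)

(* Defs.v *)
From HB Require Import structures.
From mathcomp Require Import all_boot all_order all_algebra all_fingroup.
From mathcomp Require Import boolp classical_sets functions cardinality reals.

Set Implicit Arguments.
Unset Strict Implicit.
Unset Printing Implicit Defensive.

Import Order.TTheory GRing.Theory Num.Theory.

Local Open Scope classical_set_scope.
Local Open Scope ring_scope.

Definition phi (R : realType) : R := (1 + Num.sqrt 5) / 2.

Definition vec3 (R : realType) (x y z : R) : 'rV[R]_3 :=
  \row_(i < 3) [:: x; y; z]`_i.

(* The quaternion w + xi + yj + zk is the row vector (w, x, y, z). *)
Definition quat (R : realType) (w x y z : R) : 'rV[R]_4 :=
  \row_(i < 4) [:: w; x; y; z]`_i.

Definition scalar_part (R : realType) (q : 'rV[R]_4) : R := q 0 0.

(* Squared Euclidean norm; the norm `|u| that MathComp-Analysis puts on row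
   vectors is the sup norm. *)
Definition sqnorm (R : realType) (n : nat) (u : 'rV[R]_n) : R :=
  \sum_(i < n) u 0 i ^+ 2.

(* The vectors (± u_0, ..., ± u_(n-1)), signs being independent. *)
Definition sign_choices (R : realType) (n : nat) (u : 'rV[R]_n) :
    set 'rV[R]_n :=
  [set v | forall i, v 0 i = u 0 i \/ v 0 i = - u 0 i].

(* The sum i + k is taken modulo 3, in the additive group 'I_3. *)
Definition cyclic_perms (R : realType) (u : 'rV[R]_3) : set 'rV[R]_3 :=
  [set \row_(i < 3) u 0 (i + k) | k in [set: 'I_3]].

Definition even_perms (R : realType) (n : nat) (u : 'rV[R]_n) :
    set 'rV[R]_n :=
  [set col_perm s u | s in [set s : 'S_n | ~~ odd_perm s]].

Definition signed_cyclic_perms (R : realType) (u : 'rV[R]_3) :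
    set 'rV[R]_3 :=
  \bigcup_(v in sign_choices u) cyclic_perms v.

Definition binary_icosahedral (R : realType) : set 'rV[R]_4 :=
  let f := phi R in
  [set q | exists i : 'I_4, q = delta_mx 0 i \/ q = - delta_mx 0 i]
  `|` sign_choices (2^-1 *: quat 1 1 1 1)
  `|` \bigcup_(u in sign_choices (2^-1 *: quat 0 1 f f^-1)) even_perms u.

Definition typeA (R : realType) : set 'rV[R]_3 :=
  let f := phi R in
  sign_choices (vec3 (f ^+ 2) (f ^+ 2) (f ^+ 2))
  `|` signed_cyclic_perms (vec3 (f ^+ 3) 0 f).

Definition typeC (R : realType) : set 'rV[R]_3 :=
  let f := phi R in signed_cyclic_perms (vec3 (f ^+ 3) (f ^+ 2) 0).

Definition typeB (R : realType) : set 'rV[R]_3 :=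
  let f := phi R in
  signed_cyclic_perms (vec3 (2 * f ^+ 2) 0 0)
  `|` signed_cyclic_perms (vec3 (f ^+ 3) f (f ^+ 2)).

Definition M120p_vertices (R : realType) : set 'rV[R]_3 :=
  @typeA R `|` @typeC R `|` @typeB R.

(* (x', y', z') *)
Definition scaled_vertex (R : realType) (v : 'rV[R]_3) : 'rV[R]_3 :=
  (2 * phi R ^+ 2)^-1 *: v.

(* r' *)
Definition vertex_radius (R : realType) (v : 'rV[R]_3) : R :=
  Num.sqrt (sqnorm (scaled_vertex v)).

(* w; since Num.sqrt is 0 on negative numbers, this has its intended meaning
   only when vertex_radius v <= 1. *)
Definition vertex_scalar (R : realType) (v : 'rV[R]_3) : R :=
  Num.sqrt (1 - vertex_radius v ^+ 2).

Definition vertex_quat (R : realType) (v : 'rV[R]_3) : 'rV[R]_4 :=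
  let u := scaled_vertex v in
  quat (vertex_scalar v) (u 0 0) (u 0 1) (u 0 2).

(* Main.v *)
Require Import Defs.
From HB Require Import structures.
From mathcomp Require Import all_boot all_order all_algebra all_fingroup.
From mathcomp Require Import boolp classical_sets functions cardinality reals.
From mathcomp Require Import ring lra.

Set Implicit Arguments.
Unset Strict Implicit.
Unset Printing Implicit Defensive.

Import Order.TTheory GRing.Theory Num.Theory.

Local Open Scope card_scope.
Local Open Scope classical_set_scope.
Local Open Scope ring_scope.

(** Dividing by 2 phi^2 turns every coordinate of a vertex into 0, +-1/(2 phi),
    +-1/2, +-phi/2 or +-1, which are also the coordinates of the elements of
    2I.  These nine numbers increase strictly, so they can be coded faithfully
    by the integers -4, ..., 4, with negation of codes matching negation of
    numbers ([coordN], [coord_inj]).  Sign choices, cyclic permutations and even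
    permutations of a coded vector then become operations on lists of integers
    ([sign_choices_decode], [signed_cyclic_perms_decode], [even_perms_decode]),
    so that each of the vertex types and 2I is the injective image of an
    explicit finite list, and its cardinal is the length of that list
    ([card_decoded]).

    The scalar w depends only on the squared norm of the vertex, which sign
    choices and cyclic permutations preserve.  The relation phi^2 = phi + 1
    gives the squared norms 3 phi^4 = (1 - 1/4) (2 phi^2)^2 for type A,
    phi^6 + phi^4 = (1 - 1/(4 phi^2)) (2 phi^2)^2 for type C and
    4 phi^4 = (2 phi^2)^2 for type B, hence the three values of w
    ([typeA_scalar], [typeC_scalar], [typeB_scalar]).

    The quaternion of a vertex coded by s is therefore coded by s preceded by
    the code 2, 1 or 0 of its scalar part.  The 62 lists so obtained are, up to
    order, those among the 120 lists of 2I that start with 0, 1 or 2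
    ([icosahedral_codes_small_scalar]), a comparison of two lists of integers
    done by computation.  This gives the last equality of sets, and with it the
    membership of each quaternion in 2I. *)

(** * The golden ratio *)

Section GoldenRatio.
Variable R : realType.

Lemma phi_gt1 : 1 < phi R.
Proof.
have h : (1 : R) < Num.sqrt 5.
  by rewrite -[ltLHS]sqrtr1 ltr_sqrt ?ltr1n // ltr0n.
rewrite /phi; lra.
Qed.

Lemma phi_neq0 : phi R != 0.
Proof. by rewrite gt_eqF // (lt_trans ltr01 phi_gt1). Qed.

Lemma phi_sqr : phi R ^+ 2 = phi R + 1.
Proof.
have h : Num.sqrt 5 ^+ 2 = 5 :> R by rewrite sqr_sqrtr.
by rewrite /phi expr_div_n sqrrD h; field.
Qed.

Lemma phi_inv : (phi R)^-1 = phi R - 1.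
Proof.
apply: (mulfI phi_neq0); rewrite mulfV ?phi_neq0 //.
have := phi_sqr; lra.
Qed.

Definition vertex_scale : R := 2 * phi R ^+ 2.

Lemma vertex_scale_neq0 : vertex_scale != 0.
Proof. by rewrite mulf_neq0 ?expf_neq0 ?phi_neq0 ?pnatr_eq0. Qed.

End GoldenRatio.

(** * Permutations of a given parity as words *)

(** The words of the permutations of parity b, found by choosing the image j
    of 0: the parity of [lift_perm ord0 j t] is that of j plus that of t. *)
Fixpoint parity_words (n : nat) (b : bool) : seq (seq nat) :=
  if n is m.+1 then
    flatten [seq [seq j :: map (bump j) w | w <- parity_words m (b (+) odd j)]
            | j <- iota 0 n]
  else if b then [::] else [:: [::]].

Definition perm_word n (s : 'S_n) : seq nat := [seq val (s i) | i <- enum 'I_n].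

Lemma perm_word_lift n (j : 'I_n.+1) (t : 'S_n) :
  perm_word (lift_perm ord0 j t) = val j :: map (bump j) (perm_word t).
Proof.
rewrite /perm_word enum_ordSl /= lift_perm_id -!map_comp; congr (_ :: _).
by apply: eq_map => i /=; rewrite lift_perm_lift.
Qed.

(** With [perm_word_lift], this is what allows induction on n over the
    permutations of n points, parity included. *)
Lemma perm_is_lift n (s : 'S_n.+1) :
  exists t : 'S_n, s = lift_perm ord0 (s ord0) t.
Proof.
have sl k : {l | s (lift ord0 k) = lift (s ord0) l}.
  have neq : s ord0 != s (lift ord0 k).
    by rewrite (inj_eq perm_inj) neq_lift.
  by have [l -> _] := unlift_some neq; exists l.
have inj : injective (fun k => sval (sl k)).
  move=> k l; case: (sl k) => k' /= ek; case: (sl l) => l' /= el e.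
  by apply: (lift_inj (h := ord0)); apply: (perm_inj (s := s)); rewrite ek el e.
exists (perm inj); apply/permP => i.
case: (unliftP ord0 i) => [k ->|->]; last by rewrite lift_perm_id.
by rewrite lift_perm_lift permE; case: (sl k).
Qed.

Lemma parity_wordsP n b w :
  reflect (exists2 s : 'S_n, odd_perm s = b & w = perm_word s)
          (w \in parity_words n b).
Proof.
apply: (iffP idP).
  elim: n b w => [|n IHn] b w.
    case: b => //; rewrite inE => /eqP ->; exists 1%g; first exact: odd_perm1.
    by rewrite /perm_word enum_ord0.
  move=> /flatten_mapP[j]; rewrite mem_iota add0n => /andP[_ jn].
  move=> /mapP[w' /IHn[t ot ->] ->].
  exists (lift_perm ord0 (Ordinal jn) t); last by rewrite perm_word_lift.
  by rewrite odd_lift_perm ot /= addbC -addbA addbb addbF.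
case=> s <- -> {b w}.
elim: n s => [|n IHn] s.
  have -> : s = 1%g by apply/permP; case.
  by rewrite odd_perm1 /perm_word enum_ord0.
have [t ->] := perm_is_lift s; set j := s ord0.
rewrite perm_word_lift; apply/flatten_mapP; exists (val j).
  by rewrite mem_iota add0n /=.
by apply: map_f; rewrite odd_lift_perm /= [odd j (+) _]addbC -addbA addbb addbF.
Qed.

(** * Coding coordinates by small integers *)

Section Codes.
Variable R : realType.

Definition magnitudes : seq R :=
  [:: 0; (phi R)^-1 / 2; 2^-1; phi R / 2; 1].

Definition coord (z : int) : R :=
  if 0 <= z then magnitudes`_(absz z) else - magnitudes`_(absz z).

Lemma coordN z : coord (- z) = - coord z.
Proof.
rewrite /coord abszN oppr_ge0; case: (ltgtP z 0) => [z0|z0|->].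
- by rewrite opprK.
- by [].
- by rewrite absz0 /= oppr0.
Qed.

Lemma sorted_magnitudes : sorted <%R magnitudes.
Proof.
have f1 := phi_gt1 R; have f2 := phi_sqr R; have fi := phi_inv R.
rewrite /= !andbT fi; apply/and4P; split; nra.
Qed.

(** Beyond 4 the coordinate of a code is the default value 0. *)
Definition code_bound := [pred z : int | (absz z < 5)%N].

Lemma normr_coord z : z \in code_bound -> `|coord z| = magnitudes`_(absz z).
Proof.
rewrite inE => zb; have m0 : 0 <= magnitudes`_(absz z).
  have /= := sorted_magnitudes; rewrite andbT => /and4P[m1 m2 m3 m4].
  by move: (absz z) zb => [|[|[|[|[|m]]]]] //= _; lra.
by rewrite /coord; case: ifP => _; rewrite ?normrN ger0_norm.
Qed.

(** The absolute value of a coordinate determines that of its code, the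
    magnitudes being distinct; opposite codes with the same coordinate are then
    both 0. *)
Lemma coord_inj : {in code_bound &, injective coord}.
Proof.
have um : uniq magnitudes.
  by apply: sorted_uniq sorted_magnitudes; [exact: lt_trans|exact: ltxx].
have m_inj z t : z \in code_bound -> t \in code_bound ->
    magnitudes`_(absz z) = magnitudes`_(absz t) -> absz z = absz t.
  by move=> zb tb /eqP; rewrite nth_uniq // => /eqP.
move=> z t zb tb e.
have /m_inj : magnitudes`_(absz z) = magnitudes`_(absz t).
  by rewrite -!normr_coord // e.
move=> /(_ zb tb) ezt.
have : `|z| == `|t| by rewrite -!abszE ezt.
rewrite eqr_norm2 => /orP[/eqP//|/eqP zt].
have c0 : coord t = 0 by move: e; rewrite zt coordN; lra.
have /m_inj : magnitudes`_(absz t) = magnitudes`_(absz (0 : int)).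
  by rewrite -!normr_coord // c0 /coord /=.
move=> /(_ tb isT) /eqP; rewrite absz0 absz_eq0 => /eqP t0.
by rewrite zt t0 oppr0.
Qed.

(** The factor c is 2 phi^2 for vertices and 1 for quaternions. *)
Definition decode (c : R) (n : nat) (s : seq int) : 'rV[R]_n :=
  \row_i (c * coord s`_i).

Definition codewords (n : nat) :=
  [pred s : seq int | (size s == n) && all (mem code_bound) s].

Lemma decode_inj c n : c != 0 -> {in codewords n &, injective (decode c n)}.
Proof.
move=> c0 s t /andP[/eqP ss sb] /andP[/eqP st tb] e.
apply: (@eq_from_nth _ 0) => [|i]; rewrite ss ?st // => ni.
have /rowP /(_ (Ordinal ni)) := e; rewrite !mxE => /(mulfI c0) /coord_inj.
by apply; [apply: (allP sb)|apply: (allP tb)]; rewrite mem_nth ?ss ?st.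
Qed.

Definition decoded (c : R) (n : nat) (L : seq (seq int)) : set 'rV[R]_n :=
  [set decode c n s | s in [set` L]].
Arguments decoded : clear implicits.

Lemma decodedU c n (L M : seq (seq int)) :
  decoded c n L `|` decoded c n M = decoded c n (L ++ M).
Proof.
rewrite /decoded -image_setU; congr (_ @` _).
by apply/seteqP; split=> s /=; rewrite mem_cat => /orP.
Qed.

Lemma card_decoded c n (L : seq (seq int)) :
  c != 0 -> all (codewords n) L -> uniq L -> decoded c n L #= `I_(size L).
Proof.
move=> c0 /allP Ln uL.
have -> : decoded c n L = (fun i => decode c n (nth [::] L i)) @` `I_(size L).
  apply/seteqP; split=> q [s /= sL <-].
    by exists (index s L); rewrite /= ?index_mem ?nth_index.
  by exists (nth [::] L s) => //=; rewrite mem_nth.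
apply: inj_card_eq => i j; rewrite !inE /= => iL jL e.
apply/eqP; rewrite -(nth_uniq [::] iL jL uL); apply/eqP.
by apply: (decode_inj c0 _ _ e); apply: Ln; rewrite mem_nth.
Qed.

(** A zero entry gets one sign only, so that the lists produced are distinct
    and can be counted. *)
Fixpoint signs (s : seq int) : seq (seq int) :=
  if s is z :: s' then
    [seq e :: t | e <- if z == 0 then [:: 0] else [:: z; - z], t <- signs s']
  else [:: [::]].

Lemma signsP s t :
  reflect (size t = size s /\ forall i, t`_i = s`_i \/ t`_i = - s`_i)
          (t \in signs s).
Proof.
have headE z e :
    (e \in if z == 0 then [:: 0] else [:: z; - z]) = (e == z) || (e == - z).
  by case: (z =P 0) => [->|_]; rewrite !inE // oppr0 orbb.
apply: (iffP idP).
  elim: s t => [|z s IHs] t /=.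
    by rewrite inE => /eqP ->; split=> // i; left.
  case/allpairsP=> -[e t'] /= [+ /IHs[sz tP] ->]; rewrite headE => eP.
  split=> [|[|i]] /=; rewrite ?sz //.
  by case/orP: eP => /eqP; [left|right].
elim: s t => [|z s IHs] [|e t] /= [] //= [sz] tP.
apply/allpairsP; exists (e, t); split=> //=.
  by rewrite headE; case: (tP 0%N) => /= ->; rewrite eqxx ?orbT.
by apply: IHs; split=> // i; apply: (tP i.+1).
Qed.

(** The negative of a coordinate is the coordinate of the negative code, so
    sign choices commute with decoding. *)
Lemma sign_choices_decode c n s : size s = n ->
  sign_choices (decode c n s) = decoded c n (signs s).
Proof.
move=> sn; apply/seteqP; split=> [v hv|_ [t /= /signsP[_ tP] <-] i]; last first.
  by rewrite !mxE; case: (tP i) => ->; [left|right]; rewrite ?coordN ?mulrN.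
(* The code is read off from v by testing at each index which sign occurs. *)
pose t := [seq if v 0 i == c * coord s`_i then s`_i else - s`_i
          | i <- enum 'I_n].
have tE (i : 'I_n) : t`_i = if v 0 i == c * coord s`_i then s`_i else - s`_i.
  by rewrite (nth_map i) ?size_enum_ord // nth_ord_enum.
have tn : size t = n by rewrite size_map size_enum_ord.
exists t => /=.
  apply/signsP; split=> [|i]; first by rewrite tn sn.
  have [ni|ni] := ltnP i n; last by left; rewrite !nth_default ?tn ?sn.
  by rewrite (tE (Ordinal ni)) /=; case: ifP => _; [left|right].
apply/rowP => i; rewrite !mxE tE; case: eqP => [->//|ne].
by case: (hv i); rewrite !mxE // coordN mulrN.
Qed.

Definition rotations (L : seq (seq int)) : seq (seq int) :=
  [seq rot k s | s <- L, k <- iota 0 3].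

(** Adding k to the index modulo 3 is rotating the list by k. *)
Lemma signed_cyclic_perms_decode c s : size s = 3%N ->
  signed_cyclic_perms (decode c 3 s) = decoded c 3 (rotations (signs s)).
Proof.
have rotE (t : seq int) (k : 'I_3) : size t = 3%N ->
    \row_(i < 3) decode c 3 t 0 (i + k) = decode c 3 (rot k t).
  case: t => [//|x [//|y [//|z [|a t //]]]] t3; apply/rowP => i; rewrite !mxE.
  by case: k => [[|[|[|]]]] //= ?; case: i => [[|[|[|]]]].
have sz t : size s = 3%N -> t \in signs s -> size t = 3%N.
  by move=> s3 /signsP[-> _].
move=> s3.
rewrite /signed_cyclic_perms sign_choices_decode //.
apply/seteqP; split=> [_ [_ [t /= ts <-] [k _ <-]]|_ [r /= rL <-]].
  have t3 := sz _ s3 ts.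
  rewrite rotE //.
  exists (rot k t); last by [].
  apply/allpairsP; exists (t, val k); split=> //.
  by rewrite mem_iota ltn_ord.
case/allpairsP: rL => -[t k] [ts k3 ->]; rewrite mem_iota add0n in k3.
exists (decode c 3 t); first by exists t.
by exists (Ordinal k3); rewrite // rotE // (sz _ s3 ts).
Qed.

Definition even_rearrangements (n : nat) (L : seq (seq int)) : seq (seq int) :=
  [seq [seq s`_i | i <- w] | s <- L, w <- parity_words n false].

Lemma even_perms_decode c n s : size s = n ->
  \bigcup_(u in sign_choices (decode c n s)) even_perms u =
  decoded c n (even_rearrangements n (signs s)).
Proof.
have permE (t : seq int) (p : 'S_n) :
    col_perm p (decode c n t) = decode c n [seq t`_i | i <- perm_word p].
  apply/rowP => i; rewrite !mxE /perm_word -map_comp.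
  by rewrite (nth_map i) ?size_enum_ord // nth_ord_enum.
move=> sn; rewrite sign_choices_decode //.
apply/seteqP; split=> [_ [_ [t /= ts <-] [p /= pe <-]]|_ [r /= rL <-]].
  rewrite permE; exists [seq t`_i | i <- perm_word p] => //=.
  apply/allpairsP; exists (t, perm_word p); split=> //=.
  by apply/parity_wordsP; exists p => //; apply/negbTE.
case/allpairsP: rL => -[t w] /= [ts /parity_wordsP[p pe ->] ->].
by exists (decode c n t); [exists t|exists p; rewrite ?permE //= pe].
Qed.

End Codes.
Arguments decoded {R} c n L.

(** * The vertices and the binary icosahedral group as coded lists *)

Section Polytope.
Variable R : realType.
Local Notation K := (vertex_scale R).

(** The codes 1, 2, 3, 4 stand for phi, phi^2, phi^3 and 2 phi^2 once scaled
    by 2 phi^2. *)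
Definition typeA_codes : seq (seq int) :=
  signs [:: 2; 2; 2] ++ rotations (signs [:: 3; 0; 1]).

Definition typeC_codes : seq (seq int) := rotations (signs [:: 3; 2; 0]).

Definition typeB_codes : seq (seq int) :=
  rotations (signs [:: 4; 0; 0]) ++ rotations (signs [:: 3; 1; 2]).

Definition axis_code (i : nat) (e : int) : seq int :=
  [seq if i == j then e else 0 | j <- iota 0 4].

Lemma vec3_decode (c : R) x y z :
  vec3 (c * coord R x) (c * coord R y) (c * coord R z) =
  decode c 3 [:: x; y; z].
Proof. by apply/rowP => i; rewrite !mxE; case: i => [[|[|[|]]]]. Qed.

Lemma quat_decode w x y z :
  quat (coord R w) (coord R x) (coord R y) (coord R z) =
  decode (1 : R) 4 [:: w; x; y; z].
Proof. by apply/rowP => i; rewrite !mxE mul1r; case: i => [[|[|[|[|]]]]]. Qed.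

Lemma typeA_decoded : @typeA R = decoded K 3 typeA_codes.
Proof.
have f0 := phi_neq0 R.
rewrite -decodedU -sign_choices_decode // -signed_cyclic_perms_decode //.
rewrite -!vec3_decode /coord /= /vertex_scale /typeA.
by congr (sign_choices (vec3 _ _ _) `|` signed_cyclic_perms (vec3 _ _ _));
   field.
Qed.

Lemma typeC_decoded : @typeC R = decoded K 3 typeC_codes.
Proof.
rewrite -signed_cyclic_perms_decode // -vec3_decode /coord /= /vertex_scale.
by congr (signed_cyclic_perms (vec3 _ _ _)); field.
Qed.

Lemma typeB_decoded : @typeB R = decoded K 3 typeB_codes.
Proof.
have f0 := phi_neq0 R.
rewrite -decodedU -!signed_cyclic_perms_decode //.
rewrite -!vec3_decode /coord /= /vertex_scale /typeB.
by congr (signed_cyclic_perms (vec3 _ _ _) `|`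
          signed_cyclic_perms (vec3 _ _ _)); field.
Qed.

Definition axis_codes : seq (seq int) :=
  [seq axis_code i e | i <- iota 0 4, e <- [:: 4; - 4]].

Lemma axis_decode :
  [set q : 'rV[R]_4 | exists i, q = delta_mx 0 i \/ q = - delta_mx 0 i] =
  decoded 1 4 axis_codes.
Proof.
(* The code 4 is the coordinate 1. *)
have deltaE (i : 'I_4) (b : bool) :
    (-1) ^+ b *: delta_mx 0 i =
    decode (1 : R) 4 (axis_code i ((-1) ^+ b * 4)).
  apply/rowP => j; rewrite !mxE mul1r (nth_map 0%N) ?size_iota //.
  rewrite nth_iota // add0n eqxx /= -val_eqE [val j == _]eq_sym.
  by case: b; case: eqP => _; rewrite ?mulr0 // ?mulr1 ?mul1r.
apply/seteqP; split=> [q [i iq]|_ [t /= tL <-]].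
  have [b ->] : exists b : bool, q = (-1) ^+ b *: delta_mx 0 i.
    case: iq => ->; first by exists false; rewrite scale1r.
    by exists true; rewrite scaleN1r.
  rewrite deltaE; exists (axis_code i ((-1) ^+ b * 4)) => //.
  apply/allpairsP; exists (val i, (-1) ^+ b * 4); split=> //.
    by rewrite mem_iota ltn_ord.
  by case: b; rewrite !inE ?mulN1r ?mul1r eqxx ?orbT.
case/allpairsP: tL => -[i e] [i4 eP ->]; rewrite mem_iota add0n in i4.
exists (Ordinal i4); rewrite !inE in eP.
have := deltaE (Ordinal i4); case/orP: eP => /eqP -> dE.
  by left; rewrite -[RHS]scale1r (dE false).
by right; rewrite -scaleN1r (dE true).
Qed.

Definition icosahedral_codes : seq (seq int) :=
  axis_codes ++ signs [:: 2; 2; 2; 2]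
  ++ even_rearrangements 4 (signs [:: 0; 2; 3; 1]).

Lemma binary_icosahedral_decoded :
  @binary_icosahedral R = decoded 1 4 icosahedral_codes.
Proof.
have quat4 w x y z : 2^-1 *: quat w x y z =
    quat (w / 2) (x / 2) (y / 2) (z / 2) :> 'rV[R]_4.
  by apply/rowP => i; rewrite !mxE mulrC; case: i => [[|[|[|[|]]]]].
rewrite -decodedU -[decoded _ _ (signs _ ++ _)]decodedU -axis_decode.
rewrite -sign_choices_decode // -even_perms_decode // -!quat_decode /coord /=.
by rewrite /binary_icosahedral !quat4 !mul1r mul0r setUA.
Qed.

End Polytope.

(** * Norms and scalar parts *)

Section Norms.
Variable R : realType.

Lemma sqnorm_sign_choices n (u v : 'rV[R]_n) :
  sign_choices u v -> sqnorm v = sqnorm u.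
Proof.
by move=> uv; apply: eq_bigr => i _; case: (uv i) => ->; rewrite ?sqrrN.
Qed.

Lemma sqnorm_signed_cyclic_perms (u v : 'rV[R]_3) :
  signed_cyclic_perms u v -> sqnorm v = sqnorm u.
Proof.
case=> w uw [k _ <-]; rewrite -(sqnorm_sign_choices uw) /sqnorm.
rewrite [RHS](reindex_inj (addIr k)).
by apply: eq_bigr => i _; rewrite mxE.
Qed.

Lemma sqnorm_vec3 (x y z : R) : sqnorm (vec3 x y z) = x ^+ 2 + y ^+ 2 + z ^+ 2.
Proof. by rewrite /sqnorm !big_ord_recr big_ord0 !mxE /= add0r. Qed.

Lemma sqnormZ n c (u : 'rV[R]_n) : sqnorm (c *: u) = c ^+ 2 * sqnorm u.
Proof. by rewrite mulr_sumr; apply: eq_bigr => i _; rewrite mxE exprMn. Qed.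

Lemma vertex_radius_sqr (v : 'rV[R]_3) :
  vertex_radius v ^+ 2 = sqnorm (scaled_vertex v).
Proof. by rewrite sqr_sqrtr // sumr_ge0 // => i _; rewrite sqr_ge0. Qed.

(** If the scaled vertex has squared norm 1 - a^2, then w is the nonnegative
    number whose square is a^2. *)
Lemma vertex_scalar_radius (v : 'rV[R]_3) a : 0 <= a ->
  sqnorm v = (1 - a ^+ 2) * vertex_scale R ^+ 2 ->
  vertex_scalar v = a /\ vertex_radius v <= 1.
Proof.
move=> a0 va; have rE : vertex_radius v ^+ 2 = 1 - a ^+ 2.
  rewrite vertex_radius_sqr sqnormZ va -/(vertex_scale R).
  by field; exact: vertex_scale_neq0.
split; first by rewrite /vertex_scalar rE subKr sqrtr_sqr ger0_norm.
by rewrite -(@ler_pXn2r _ 2) ?nnegrE ?sqrtr_ge0 // rE expr1n gerBl sqr_ge0.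
Qed.

Lemma sqnorm_vertex_quat (v : 'rV[R]_3) :
  vertex_radius v <= 1 -> sqnorm (vertex_quat v) = 1.
Proof.
move=> r1; rewrite /sqnorm big_ord_recl !mxE /= sqr_sqrtr; last first.
  by rewrite subr_ge0 exprn_ile1 ?sqrtr_ge0.
rewrite vertex_radius_sqr /sqnorm !big_ord_recr !big_ord0 !mxE /= !add0r.
have -> : widen_ord (leqnSn 2) (widen_ord (leqnSn 1) ord_max) = 0 :> 'I_3.
  exact: val_inj.
have -> : widen_ord (leqnSn 2) ord_max = 1 :> 'I_3 by exact: val_inj.
have -> : ord_max = 2 :> 'I_3 by exact: val_inj.
by rewrite subrK.
Qed.

Lemma phi_cube : phi R ^+ 3 = 2 * phi R + 1.
Proof. by rewrite exprSr phi_sqr mulrDl mul1r -expr2 phi_sqr; ring. Qed.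

Lemma typeA_scalar (v : 'rV[R]_3) :
  typeA v -> vertex_scalar v = 1 / 2 /\ vertex_radius v <= 1.
Proof.
move=> vA; apply: vertex_scalar_radius; first by lra.
rewrite /vertex_scale.
case: vA => [/sqnorm_sign_choices|/sqnorm_signed_cyclic_perms] ->;
  rewrite sqnorm_vec3; first by field.
by rewrite phi_cube phi_sqr; have := phi_sqr R; lra.
Qed.

Lemma typeC_scalar (v : 'rV[R]_3) :
  typeC v -> vertex_scalar v = 1 / (2 * phi R) /\ vertex_radius v <= 1.
Proof.
have f0 := phi_neq0 R; have f1 := phi_gt1 R; have p2 := phi_sqr R.
move=> /sqnorm_signed_cyclic_perms vC; apply: vertex_scalar_radius.
  by rewrite divr_ge0 // mulr_ge0 // ltW // (lt_trans ltr01).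
rewrite vC sqnorm_vec3 /vertex_scale.
(* Clearing denominators first leaves a polynomial in phi. *)
transitivity (4 * (phi R ^+ 2) ^+ 2 - phi R ^+ 2); last by field.
by rewrite phi_cube p2; lra.
Qed.

Lemma typeB_scalar (v : 'rV[R]_3) :
  typeB v -> vertex_scalar v = 0 /\ vertex_radius v <= 1.
Proof.
move=> vB; apply: vertex_scalar_radius => //.
rewrite /vertex_scale.
case: vB => /sqnorm_signed_cyclic_perms ->; rewrite sqnorm_vec3.
  by field.
by rewrite phi_cube phi_sqr; have := phi_sqr R; lra.
Qed.

End Norms.

(** * The quaternions of the vertices *)

Section Quaternions.
Variable R : realType.

Lemma vertex_quat_decode (s : seq int) w :
  vertex_scalar (decode (vertex_scale R) 3 s) = coord R w ->
  vertex_quat (decode (vertex_scale R) 3 s) = decode 1 4 (w :: s).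
Proof.
move=> sw; have k0 := vertex_scale_neq0 R; rewrite /vertex_quat sw.
apply/rowP => i; rewrite !mxE mul1r -/(vertex_scale R) !mulKf //.
by case: i => [[|[|[|[|]]]]].
Qed.

Lemma vertex_quat_decoded (L : seq (seq int)) w :
  (forall v, decoded (vertex_scale R) 3 L v -> vertex_scalar v = coord R w) ->
  [set vertex_quat v | v in decoded (vertex_scale R) 3 L] =
  decoded 1 4 [seq w :: s | s <- L].
Proof.
move=> Lw; apply/seteqP; split=> [_ [v [s sL <-] <-]|_ [t /= tL <-]].
  exists (w :: s); first exact: map_f.
  by rewrite (vertex_quat_decode (w := w)) //; apply: Lw; exists s.
case/mapP: tL => s sL ->; exists (decode (vertex_scale R) 3 s).
  by exists s.
by apply: vertex_quat_decode; apply: Lw; exists s.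
Qed.

Definition vertex_codes : seq (seq int) :=
  typeA_codes ++ typeC_codes ++ typeB_codes.

Definition vertex_quat_codes : seq (seq int) :=
  [seq 2 :: s | s <- typeA_codes] ++ [seq 1 :: s | s <- typeC_codes]
  ++ [seq 0 :: s | s <- typeB_codes].

Lemma M120p_vertices_decoded :
  @M120p_vertices R = decoded (vertex_scale R) 3 vertex_codes.
Proof.
rewrite -decodedU -[decoded _ _ (typeC_codes ++ _)]decodedU setUA.
by rewrite -typeA_decoded -typeC_decoded -typeB_decoded.
Qed.

Lemma vertex_quats_decoded :
  [set vertex_quat v | v in @M120p_vertices R] = decoded 1 4 vertex_quat_codes.
Proof.
rewrite -decodedU -[decoded _ _ (map _ typeC_codes ++ _)]decodedU setUA.
rewrite -!vertex_quat_decoded; last first.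
- by rewrite -typeA_decoded => v /typeA_scalar[-> _]; rewrite /coord /= div1r.
- rewrite -typeC_decoded => v /typeC_scalar[-> _].
  by rewrite /coord /= div1r invfM mulrC.
- by rewrite -typeB_decoded => v /typeB_scalar[-> _].
rewrite -typeA_decoded -typeC_decoded -typeB_decoded.
by rewrite /M120p_vertices !image_setU.
Qed.

(** The combinatorial core: the sign conventions, the cyclic orders of the
    vertices and the even permutations of 2I match exactly. *)
Lemma icosahedral_codes_small_scalar :
  perm_eq vertex_quat_codes
    [seq s <- icosahedral_codes | s`_0 \in [:: 0; 1; 2]].
Proof. by vm_compute. Qed.

Lemma icosahedral_codes_bound : all (codewords 4) icosahedral_codes.
Proof. by vm_compute. Qed.

(** By injectivity of the coding, the condition on the scalar part of an
    element of 2I is the condition on the first entry of its code. *)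
Lemma vertex_quats_small_scalar :
  [set vertex_quat v | v in @M120p_vertices R] =
  [set q : 'rV[R]_4 | binary_icosahedral q /\
     [\/ scalar_part q = 0, scalar_part q = 1 / 2
       | scalar_part q = 1 / (2 * phi R)]].
Proof.
have c0 : coord R 0 = 0 by [].
have c1 : coord R 1 = 1 / (2 * phi R) by rewrite [RHS]div1r [RHS]invfM mulrC.
have c2 : coord R 2 = 1 / 2 by rewrite [RHS]div1r.
have scalarE s : scalar_part (decode (1 : R) 4 s) = coord R s`_0.
  by rewrite /scalar_part mxE mul1r.
have codeE s : (s \in vertex_quat_codes) =
    (s`_0 \in [:: 0; 1; 2]) && (s \in icosahedral_codes).
  by rewrite (perm_mem icosahedral_codes_small_scalar) mem_filter.
rewrite vertex_quats_decoded binary_icosahedral_decoded -c0 -c1 -c2.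
apply/seteqP; split=> [_ [s /= + <-]|_ [/= [s sI <-]]].
  rewrite codeE scalarE => /andP[s0 sI]; split; first by exists s.
  by move: s0; rewrite !inE => /or3P[] /eqP ->; constructor.
have /andP[/eqP sz /allP sb] := allP icosahedral_codes_bound s sI.
have s0b : s`_0 \in code_bound by apply: sb; rewrite mem_nth ?sz.
rewrite scalarE => s0; exists s => //=; rewrite codeE sI andbT !inE.
by case: s0 => /coord_inj -> //; rewrite eqxx ?orbT.
Qed.

End Quaternions.

Theorem mainTheorem1 (R : realType) :
  [/\ @M120p_vertices R #= `I_62, @typeA R #= `I_20,
      @typeC R #= `I_12 & @typeB R #= `I_30]
  /\ (forall v : 'rV[R]_3, M120p_vertices v ->
        [/\ vertex_radius v <= 1,
            sqnorm (vertex_quat v) = 1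
          & binary_icosahedral (vertex_quat v)])
  /\ [/\ forall v : 'rV[R]_3, typeA v -> vertex_scalar v = 1 / 2,
         forall v : 'rV[R]_3, typeC v -> vertex_scalar v = 1 / (2 * phi R)
       & forall v : 'rV[R]_3, typeB v -> vertex_scalar v = 0]
  /\ [set vertex_quat v | v in @M120p_vertices R] #= `I_62
  /\ [set vertex_quat v | v in @M120p_vertices R] =
     [set q : 'rV[R]_4 | binary_icosahedral q /\
        [\/ scalar_part q = 0, scalar_part q = 1 / 2
          | scalar_part q = 1 / (2 * phi R)]].
Proof.
have k0 := vertex_scale_neq0 R.
split.
  rewrite M120p_vertices_decoded typeA_decoded typeC_decoded typeB_decoded.
  by split; apply: card_decoded => //; vm_compute.
split.
  move=> v vM; have r1 : vertex_radius v <= 1.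
    by case: vM => [[/typeA_scalar|/typeC_scalar]|/typeB_scalar] [].
  split=> //; first exact: sqnorm_vertex_quat.
  have : [set vertex_quat v | v in @M120p_vertices R] (vertex_quat v).
    by exists v.
  by rewrite vertex_quats_small_scalar => -[].
split.
  split=> v; first by case/typeA_scalar.
  - by case/typeC_scalar.
  - by case/typeB_scalar.
split; last exact: vertex_quats_small_scalar.
rewrite vertex_quats_decoded; apply: card_decoded; first exact: oner_neq0.
- by vm_compute.
- by vm_compute.
Qed.
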